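(* Let $\Gamma_0$ have generators $a_1,\dots,a_{g_0},b_1,\dots,b_{g_0},x_1,\dots,x_r$ and defining relations $R=1$, where $R=\left(\prod_{i=1}^{g_0}[a_i,b_i]\right)x_1\cdots x_r$, and $x_j^{m_j}=1$ for $j=1,\dots,r$. Let $\Gamma=\ker\phi$ be the normal subgroup of $\Gamma_0$ with $\Gamma_0/\Gamma\cong G$. Then $\Gamma$ can be presented with generators $$S_{K,a_i},\quad S_{K,b_i}\ (i=1,\dots,g_0),\qquad S_{K,x_j}\ (j=1,\dots,r),$$ where $K$ runs over the chosen Schreier right coset representatives of $\Gamma_0$ modulo $\Gamma$, and relations $$\tau(KRK^{-1})=1,\qquad \tau(Kx_j^{m_j}K^{-1})=1\ (j=1,\dots,r),\qquad S_{M,v}=1,$$ where $K$ runs over all the coset representatives, and $(M,v)$ runs over all pairs consisting of a Schreier representative $M$ and a generator $v$ of $\Gamma_0$ such that $Mv=\overline{Mv}$.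
   Context: Setting. $S$ is a compact Riemann surface of genus $g\ge 2$, $G$ is a group of conformal automorphisms of $S$ of order $n$, and $S_0=S/G$ has genus $g_0$. $U$ is the unit disc; $\Gamma$ and $\Gamma_0$ are Fuchsian groups with $S=U/\Gamma$, $S_0=U/\Gamma_0$, and $\phi:\Gamma_0\to G$ is the surjective surface kernel homomorphism with kernel $\Gamma$. The $m_j\ge 2$ are the orders of the branch points of $S\to S_0$; $x_j$ is elliptic of order $m_j$ and $\phi(x_j)$ also has order $m_j$. $[a,b]=aba^{-1}b^{-1}$. Schreier system. Choose a set of $n$ right coset representatives (words in the generators of $\Gamma_0$) for $\Gamma_0$ modulo $\Gamma$ which is a Schreier system: every initial segment of a representative is again a representative. The representatives may be chosen minimal (each of minimal length in its coset). $K$ denotes an arbitrary representative and $\overline{X}$ denotes the representative of the coset of $X\in\Gamma_0$, so $\phi(\overline X)=\phi(X)$. For a representative $K$ and a generator $v$ of $\Gamma_0$, $S_{K,v}=Kv\,\overline{Kv}^{\,-1}\in\Gamma$. Rewriting process $\tau$. If $X=c_1^{\epsilon_1}\cdots c_u^{\epsilon_u}$ is a word in the generators of $\Gamma_0$ (each $c_i$ a generator, $\epsilon_i=\pm1$) representing an element of $\Gamma$, then $\tau(X)=\prod_{i=1}^u S_{V_i,c_i}^{\epsilon_i}$, where $V_i=\overline{c_1^{\epsilon_1}\cdots c_{i-1}^{\epsilon_{i-1}}}$ if $\epsilon_i=+1$, and $V_i=\overline{c_1^{\epsilon_1}\cdots c_{i-1}^{\epsilon_{i-1}}c_i^{-1}}$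 if $\epsilon_i=-1$. *)

(* Defs.v *)
From HB Require Import structures.
From mathcomp Require Import all_boot all_order all_fingroup all_algebra.
From mathcomp Require Import all_classical all_reals all_analysis.
From mathcomp Require Import complex.

Set Implicit Arguments.
Unset Strict Implicit.
Unset Printing Implicit Defensive.

Import Order.TTheory GRing.Theory Num.Theory.
Import numFieldNormedType.Exports.

Local Open Scope classical_set_scope.
Local Open Scope ring_scope.

(* (t, true) stands for the letter t and (t, false) for its inverse. *)
Definition word (T : Type) := seq (T * bool).

Definition inv_letter (T : Type) (c : T * bool) : T * bool := (c.1, ~~ c.2).

Definition inv_word (T : Type) (w : word T) : word T :=
  rev (map (@inv_letter T) w).

Definition eval_letter (T : Type) (H : groupType) (f : T -> H)
    (c : T * bool) : H :=
  if c.2 then f c.1 else ((f c.1)^-1)%g.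

Definition eval (T : Type) (H : groupType) (f : T -> H) (w : word T) : H :=
  (\prod_(c <- w) eval_letter f c)%g.

(* w ~ w' when w can be turned into w' by inserting and deleting relators and
   trivial pairs t t^-1, t^-1 t; equivalently, w and w' have the same image in
   the quotient of the free group on T by the normal closure of rel. *)
Inductive word_eq (T : Type) (rel : word T -> Prop) :
    word T -> word T -> Prop :=
| word_eq_refl w : word_eq rel w w
| word_eq_sym w w' : word_eq rel w w' -> word_eq rel w' w
| word_eq_trans w w' w'' :
    word_eq rel w w' -> word_eq rel w' w'' -> word_eq rel w w''
| word_eq_cancel u c v : word_eq rel (u ++ [:: c; inv_letter c] ++ v) (u ++ v)
| word_eq_rel u s v : rel s -> word_eq rel (u ++ s ++ v) (u ++ v).

Definition freely_equal (T : Type) : word T -> word T -> Prop :=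
  word_eq (fun _ => False).

(* The subgroup H of G is presented by the generators f t and the relators in
   rel: the map t |-> f t induces an isomorphism of < T | rel > onto H. *)
Record presents (T : Type) (G : groupType) (H : set G) (f : T -> G)
    (rel : word T -> Prop) : Prop := Presents {
  presents_in : forall t, H (f t);
  presents_gen : forall h, H h -> exists w, eval f w = h;
  presents_rel : forall w, eval f w = 1%g <-> word_eq rel w [::] }.

Inductive gen (g0 r : nat) : Type :=
| genA of 'I_g0
| genB of 'I_g0
| genX of 'I_r.
Arguments genA {g0 r}.
Arguments genB {g0 r}.
Arguments genX {g0 r}.

Definition gen_val (g0 r : nat) (H : Type) (a b : 'I_g0 -> H) (x : 'I_r -> H)
    (v : gen g0 r) : H :=
  match v with genA i => a i | genB i => b i | genX j => x j end.

Definition word_R (g0 r : nat) : word (gen g0 r) :=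
  flatten [seq [:: (genA i, true); (genB i, true); (genA i, false);
                   (genB i, false)] | i <- enum 'I_g0]
  ++ [seq (genX j, true) | j <- enum 'I_r].

Definition word_xm (g0 r : nat) (m : 'I_r -> nat) (j : 'I_r) :
  word (gen g0 r) := nseq (m j) (genX j, true).

Inductive fuchsian_relator (g0 r : nat) (m : 'I_r -> nat) :
    word (gen g0 r) -> Prop :=
| fuchsian_relator_R : fuchsian_relator m (word_R g0 r)
| fuchsian_relator_x j : fuchsian_relator m (word_xm g0 m j).

Section Rewriting.
Variables (T : Type) (Gam0 : groupType) (G : finGroupType).
Variables (val : T -> Gam0) (phi : Gam0 -> G).

(* A coset of ker phi is identified with its image in G, so that a system of
   representatives of the cosets is a family of words indexed by G. *)
Record schreier_system (rep : G -> word T) : Prop := SchreierSystem {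
  schreier_rep : forall k, phi (eval val (rep k)) = k;
  schreier_prefix : forall k u w, rep k = u ++ w -> exists h, rep h = u }.

Definition coset_of_word (w : word T) : G := phi (eval val w).

Variable rep : G -> word T.

Definition bar (w : word T) : word T := rep (coset_of_word w).

(* The symbol S_{K,v}, with K = rep k, is represented by the pair (k, v). *)
Definition schreier_gen (s : G * T) : Gam0 :=
  let: (k, v) := s in
  (eval val (rep k) * val v
   * (eval val (bar (rcons (rep k) (v, true))))^-1)%g.

Fixpoint tau_from (pre w : word T) : word (G * T) :=
  if w is (c, e) :: w' then
    let V := if e then coset_of_word pre
             else coset_of_word (rcons pre (c, false)) in
    ((V, c), e) :: tau_from (rcons pre (c, e)) w'
  else [::].

Definition tau (w : word T) : word (G * T) := tau_from [::] w.

Definition conj_word (k : G) (w : word T) : word T :=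
  rep k ++ w ++ inv_word (rep k).

(* In the last clause M v and its representative are compared as elements of
   the free group, so that M = M' v^-1 is allowed. *)
Inductive schreier_relator (rel : word T -> Prop) : word (G * T) -> Prop :=
| schreier_relator_conj k w :
    rel w -> schreier_relator rel (tau (conj_word k w))
| schreier_relator_triv k v :
    freely_equal (rcons (rep k) (v, true)) (bar (rcons (rep k) (v, true))) ->
    schreier_relator rel [:: ((k, v), true)].

End Rewriting.

Section Genus.
Variables (R : realType) (X : topologicalType).

Definition simple_closed_curve (c : R -> X) : Prop :=
  [/\ {within `[0, 1], continuous c}, c 0 = c 1 &
      {in `[0, 1[ &, injective c}].

Definition curve_image (c : R -> X) : set X := c @` `[0, 1].

Definition nonseparating_curves (k : nat) (c : 'I_k -> R -> X) : Prop :=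
  [/\ forall i, simple_closed_curve (c i),
      forall i j, i != j -> curve_image (c i) `&` curve_image (c j) = set0 &
      connected (~` \bigcup_i curve_image (c i))].

(* The genus of a surface: the largest number of disjoint simple closed curves
   that together do not separate it. *)
Definition has_genus (g : nat) : Prop :=
  (exists c : 'I_g -> R -> X, nonseparating_curves c) /\
  (forall k (c : 'I_k -> R -> X), nonseparating_curves c -> (k <= g)%N).

End Genus.

(* The complex numbers, as a type carrying the topology of a
   numClosedFieldType. *)
Definition Cplx (R : realType) : numClosedFieldType := R[i].

Section Fuchsian.
Variable R : realType.
Local Notation C := (Cplx R).

Definition unit_disc : set C := [set z | `|z| < 1].

Definition disc_mobius (f : C -> C) : Prop :=
  exists u v : C, `|u| ^+ 2 - `|v| ^+ 2 = 1 /\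
    forall z, unit_disc z -> f z = (u * z + v) / (v^* * z + u^*).

(* Gam0 is a discrete group of Moebius transformations of the unit disc. *)
Record fuchsian_group (Gam0 : groupType) (act : Gam0 -> C -> C) : Prop :=
  FuchsianGroup {
  fuchsian_mobius : forall x, disc_mobius (act x);
  fuchsian_mul : forall x y z, unit_disc z ->
    act (x * y)%g z = act x (act y z);
  fuchsian_faithful : forall x,
    (forall z, unit_disc z -> act x z = z) -> x = 1%g;
  fuchsian_discontinuous : forall K : set C, compact K -> K `<=` unit_disc ->
    finite_set [set x | act x @` K `&` K !=set0] }.

(* p restricted to the unit disc identifies S with its quotient by the
   subgroup H; the values of p outside the disc are irrelevant. *)
Record disc_quotient (Gam0 : groupType) (act : Gam0 -> C -> C) (H : set Gam0)
    (S : topologicalType) (p : C -> S) : Prop := DiscQuotient {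
  disc_quotient_surj : forall s, exists2 z, unit_disc z & p z = s;
  disc_quotient_eq : forall z w, unit_disc z -> unit_disc w ->
    (p z = p w <-> exists2 x, H x & w = act x z);
  disc_quotient_open : forall V : set S,
    open V <-> open (unit_disc `&` p @^-1` V) }.

Definition elliptic (Gam0 : groupType) (act : Gam0 -> C -> C) (x : Gam0) :
  Prop := x <> 1%g /\ exists2 z, unit_disc z & act x z = z.

(* The branch points of S -> S0 = S / G are the r distinct points P j, and the
   branching order over P j is m j. *)
Definition branch_data (G : finGroupType) (S S0 : topologicalType)
    (aut : G -> S -> S) (q : S -> S0) (r : nat) (m : 'I_r -> nat) : Prop :=
  exists P : 'I_r -> S0, injective P /\
    forall s : S,
      (forall j, q s = P j -> #|[pred h : G | aut h s == s]| = m j) /\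
      ((forall j, q s <> P j) -> forall h : G, aut h s = s -> h = 1%g).

(* S is the compact surface U / ker phi of genus g, with conformal structure
   coming from the unit disc U through p, and S0 = U / Gam0 = S / G has genus
   g0. By setting_aut, phi y acts on S as y acts on U, so that G is a group of
   conformal automorphisms of S; q : S -> S0 is the natural projection. *)
Record surface_setting (Gam0 : groupType) (G : finGroupType)
    (act : Gam0 -> C -> C) (phi : Gam0 -> G)
    (S S0 : topologicalType) (p : C -> S) (p0 : C -> S0)
    (aut : G -> S -> S) (q : S -> S0)
    (g g0 r : nat) (m : 'I_r -> nat) (x : 'I_r -> Gam0) : Prop :=
  SurfaceSetting {
  setting_fuchsian : fuchsian_group act;
  setting_morph : {morph phi : y z / (y * z)%g};
  setting_surj : forall k, exists y, phi y = k;
  setting_free : forall y z, phi y = 1%g -> unit_disc z -> act y z = z ->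
    y = 1%g;
  setting_S : disc_quotient act [set y | phi y = 1%g] p;
  setting_S0 : disc_quotient act setT p0;
  setting_compact : compact [set: S];
  setting_genus : has_genus R S g;
  setting_genus_ge2 : (2 <= g)%N;
  setting_genus0 : has_genus R S0 g0;
  setting_aut : forall y z, unit_disc z -> aut (phi y) (p z) = p (act y z);
  setting_proj : forall z, unit_disc z -> q (p z) = p0 z;
  setting_m_ge2 : forall j, (2 <= m j)%N;
  setting_branch : branch_data aut q m;
  setting_elliptic : forall j, elliptic act (x j);
  setting_order : forall j, #[phi (x j)]%g = m j }.

End Fuchsian.

(* Main.v *)
Require Import Defs.
From HB Require Import structures.
From mathcomp Require Import all_boot all_order all_fingroup all_algebra.
From mathcomp Require Import all_classical all_reals all_analysis.
From mathcomp Require Import complex.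

(** This is an instance of the Reidemeister-Schreier theorem, which presents the
    kernel of a homomorphism [phi] from a presented group to a finite group.

    Rewriting a word [w] from a starting word [pre] produces symbols that
    depend on [pre] only through its coset ([tau_from_coset]), and the values
    of these symbols telescope to [bar pre * w * (bar (pre w))^-1]
    ([eval_tau_from]). As the representative of the trivial coset is the empty
    word, [tau w] has the same value as [w] when [w] lies in the kernel; so the
    Schreier elements generate it, and the relators hold.

    For completeness of the relations, [spell] writes each symbol [S_{K,v}] as
    the word [K v (bar (K v))^-1]. Two facts then suffice.
    - [tau_from] carries words equal modulo [rel] to words equal modulo the
      Schreier relators ([tau_from_word_eq]).
    - Rewriting undoes spelling modulo the Schreier relators ([tau_spell]).
    If a word [w] in the symbols has value 1, then so has [spell w], which is
    therefore trivial modulo [rel], and [w ~ tau (spell w) ~ tau [::] = [::]].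

    Both facts rest on [tau_rep]: rewriting a representative gives a product of
    symbols made trivial by the relators [S_{M,v}]. This is where the prefix
    property of a Schreier system enters. *)

Set Implicit Arguments.
Unset Strict Implicit.
Unset Printing Implicit Defensive.

Local Open Scope classical_set_scope.

(* Not the evaluation map of function spaces. *)
Local Notation eval := Defs.eval.

(** * Words modulo relators *)

Section Words.
Variable T : Type.
Implicit Types (c : T * bool) (u v w : word T) (rel : word T -> Prop).

Lemma inv_letterK : involutive (@inv_letter T).
Proof. by case=> t e; rewrite /inv_letter /= negbK. Qed.

Lemma inv_word_cons c w : inv_word (c :: w) = rcons (inv_word w) (inv_letter c).
Proof. by rewrite /inv_word /= rev_cons. Qed.

Lemma inv_word_cat u v : inv_word (u ++ v) = inv_word v ++ inv_word u.
Proof. by rewrite /inv_word map_cat rev_cat. Qed.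

Lemma word_eq_ctx rel u v w w' :
  word_eq rel w w' -> word_eq rel (u ++ w ++ v) (u ++ w' ++ v).
Proof.
elim=> {w w'} [w|w w' _|w w' w'' _ IH1 _ IH2|x c y|x s y rel_s].
- exact: word_eq_refl.
- exact: word_eq_sym.
- exact: word_eq_trans IH1 IH2.
- have := word_eq_cancel rel (u ++ x) c (y ++ v).
  by rewrite /= -!catA /= -?catA.
- have := word_eq_rel (u ++ x) (y ++ v) rel_s.
  by rewrite -!catA.
Qed.

Lemma word_eq_cat rel u u' v v' :
  word_eq rel u u' -> word_eq rel v v' -> word_eq rel (u ++ v) (u' ++ v').
Proof.
move=> /(@word_eq_ctx _ [::] v) /= uu' /(@word_eq_ctx _ u' [::]).
by rewrite !cats0; apply: word_eq_trans.
Qed.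

Lemma word_eq_invr rel w : word_eq rel (w ++ inv_word w) [::].
Proof.
elim: w => [|c w IH] /=; first exact: word_eq_refl.
rewrite inv_word_cons -cats1 catA.
apply: word_eq_trans (word_eq_cancel rel [::] c [::]).
by have := word_eq_ctx [:: c] [:: inv_letter c] IH.
Qed.

Lemma word_eq_inv_nil rel w :
  word_eq rel w [::] -> word_eq rel (inv_word w) [::].
Proof.
move=> /(@word_eq_ctx _ [::] (inv_word w)) /= /word_eq_sym w1.
exact: word_eq_trans w1 (word_eq_invr rel w).
Qed.

Lemma word_eq_inv rel w w' :
  word_eq rel w w' -> word_eq rel (inv_word w) (inv_word w').
Proof.
elim=> {w w'} [w|w w' _|w w' w'' _ IH1 _ IH2|u c v|u s v rel_s].
- exact: word_eq_refl.
- exact: word_eq_sym.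
- exact: word_eq_trans IH1 IH2.
- rewrite !inv_word_cat -catA -[inv_word [:: _; _]]/[:: _; _] inv_letterK.
  exact: word_eq_cancel.
- rewrite !inv_word_cat -catA.
  apply: (word_eq_ctx _ _ (w' := [::])); apply: word_eq_inv_nil.
  by have := word_eq_rel [::] [::] rel_s; rewrite cats0.
Qed.

Variables (H : groupType) (f : T -> H).

Lemma eval_nil : eval f [::] = 1%g.
Proof. exact: big_nil. Qed.

Lemma eval_cons c w : eval f (c :: w) = (eval_letter f c * eval f w)%g.
Proof. exact: big_cons. Qed.

Lemma eval_cat u v : eval f (u ++ v) = (eval f u * eval f v)%g.
Proof. exact: big_cat. Qed.

Lemma eval_letter_inv c : eval_letter f (inv_letter c) = ((eval_letter f c)^-1)%g.
Proof. by case: c => t [] //=; rewrite /eval_letter /= invgK. Qed.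

Lemma eval_inv w : eval f (inv_word w) = ((eval f w)^-1)%g.
Proof.
elim: w => [|c w IH]; first by rewrite eval_nil invg1.
rewrite inv_word_cons -cats1 eval_cat IH !eval_cons eval_nil mulg1.
by rewrite eval_letter_inv invgM.
Qed.

Lemma word_eq_eval rel w w' :
    (forall s, rel s -> eval f s = 1%g) ->
  word_eq rel w w' -> eval f w = eval f w'.
Proof.
move=> rel1; elim=> {w w'} [//|//|w w' w'' _ -> //|u c v|u s v /rel1 s1].
  by rewrite !eval_cat !eval_cons eval_nil eval_letter_inv mulg1 mulgV mul1g.
by rewrite !eval_cat s1 mul1g.
Qed.

End Words.

(** * Cosets and their representatives *)

Section ReidemeisterSchreier.
Variables (T : Type) (Gam0 : groupType) (G : finGroupType).
Variables (val : T -> Gam0) (phi : Gam0 -> G) (rep : G -> word T).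
Variable rel : word T -> Prop.
Hypothesis phiM : {morph phi : y z / (y * z)%g}.
Hypothesis presT : presents setT val rel.
Hypothesis schreier : schreier_system val phi rep.
Implicit Types (pre u v w : word T) (k : G).

Local Notation coset := (coset_of_word val phi).
Local Notation barw := (bar val phi rep).
Local Notation sgen := (schreier_gen val phi rep).
Local Notation tauf := (tau_from val phi).
Local Notation srel := (schreier_relator val phi rep rel).

Lemma phi1 : phi 1%g = 1%g.
Proof. by apply: (mulgI (phi 1%g)); rewrite -phiM !mulg1. Qed.

Lemma phiV y : phi (y^-1)%g = ((phi y)^-1)%g.
Proof. by apply: (mulgI (phi y)); rewrite -phiM !mulgV phi1. Qed.

Lemma coset_cat u v : coset (u ++ v) = (coset u * coset v)%g.
Proof. by rewrite /coset_of_word eval_cat phiM. Qed.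

Lemma coset_rep k : coset (rep k) = k.
Proof. exact: schreier_rep schreier k. Qed.

Lemma coset_nil : coset [::] = 1%g.
Proof. by rewrite /coset_of_word eval_nil phi1. Qed.

Lemma coset_inv w : coset (inv_word w) = ((coset w)^-1)%g.
Proof. by rewrite /coset_of_word eval_inv phiV. Qed.

Lemma coset_cancel pre c :
  coset (rcons (rcons pre c) (inv_letter c)) = coset pre.
Proof.
rewrite -!cats1 !coset_cat /coset_of_word !eval_cons eval_nil !mulg1.
by rewrite eval_letter_inv phiV mulgK.
Qed.

Lemma rep_prefix k u v : rep k = u ++ v -> rep (coset u) = u.
Proof.
by move=> /(schreier_prefix schreier) [h <-]; rewrite coset_rep.
Qed.

Lemma rep1 : rep 1%g = [::].
Proof. by rewrite -coset_nil (@rep_prefix 1%g [::] (rep 1%g)). Qed.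

(** * The rewriting process *)

Lemma tau_from_cat pre u v :
  tauf pre (u ++ v) = tauf pre u ++ tauf (pre ++ u) v.
Proof.
elim: u pre => [|[t e] u IH] pre /=; first by rewrite cats0.
by rewrite IH cat_rcons.
Qed.

Lemma tau_from_coset pre pre' w :
  coset pre = coset pre' -> tauf pre w = tauf pre' w.
Proof.
elim: w pre pre' => [//|[t e] w IH] pre pre' eq_pre /=.
have eq_rcons c : coset (rcons pre c) = coset (rcons pre' c).
  by rewrite -!cats1 !coset_cat eq_pre.
by rewrite eq_pre !eq_rcons; congr (_ :: _); exact: IH.
Qed.

(** A letter and its inverse, read in opposite directions across the same
    edge of the coset graph, carry the same symbol: this is why the definition
    of [tau] takes a different coset for a letter of exponent -1. *)
Lemma tau_from_inv pre w :
  tauf (pre ++ w) (inv_word w) = inv_word (tauf pre w).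
Proof.
elim: w pre => [//|[t e] w IH] pre.
rewrite inv_word_cons -cats1 tau_from_cat -cat_rcons IH.
have tail c : coset ((rcons pre c ++ w) ++ inv_word w) = coset (rcons pre c).
  by rewrite !coset_cat coset_inv mulgK.
rewrite (tau_from_coset _ (tail _)) /= inv_word_cons cats1.
case: e => //; have := coset_cancel pre (t, true).
by rewrite /inv_letter /= => ->.
Qed.

(** Each symbol contributes [bar u * c * (bar (u c))^-1], where [u] is what has
    been read so far and [c] is the next letter, whatever the exponent of [c];
    the inner representatives cancel. *)
Lemma eval_tau_from pre w :
  eval sgen (tauf pre w) =
  (eval val (barw pre) * eval val w * (eval val (barw (pre ++ w)))^-1)%g.
Proof.
elim: w pre => [|[t e] w IH] pre /=.
  by rewrite cats0 !eval_nil mulg1 mulgV.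
rewrite eval_cons IH cat_rcons eval_cons !mulgA; congr (_ * _ * _)%g.
have barE u c : barw (rcons (rep (coset u)) c) = barw (rcons u c).
  by rewrite /bar -!cats1 !coset_cat coset_rep.
case: e; rewrite /eval_letter /= barE; first by rewrite mulgVK.
have -> : barw (rcons (rcons pre (t, false)) (t, true)) = barw pre.
  by rewrite /bar (coset_cancel pre (t, false)).
by rewrite !invgM invgK -!mulgA mulVg mulg1.
Qed.

Lemma eval_tau w : coset w = 1%g -> eval sgen (tau val phi w) = eval val w.
Proof.
move=> w1; rewrite /tau eval_tau_from /bar w1 coset_nil rep1 eval_nil.
by rewrite invg1 mul1g mulg1.
Qed.

Lemma rel_eval s : rel s -> eval val s = 1%g.
Proof.
move=> rel_s; apply/(presents_rel presT).
by have := word_eq_rel [::] [::] rel_s; rewrite cats0.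
Qed.

(** * Rewriting modulo the Schreier relators *)

(** By induction along the prefixes. A positive last letter of a representative
    gives a symbol [S_{M,v}] with [M v] a representative. A negative last
    letter, [K = M v^-1], gives the inverse of [S_{K,v}], and [K v] is freely
    equal to the representative [M]. *)
Lemma tau_rep k : word_eq srel (tauf [::] (rep k)) [::].
Proof.
have [u] : exists u, u = rep k by exists (rep k).
elim/last_ind: u k => [|u [t e] IH] k def_k; rewrite -def_k.
  exact: word_eq_refl.
have rep_u : rep (coset u) = u.
  by apply: (@rep_prefix k _ [:: (t, e)]); rewrite cats1.
rewrite -cats1 tau_from_cat -[X in word_eq _ _ X]cats0.
apply: word_eq_cat; first by rewrite -rep_u; apply: IH.
have rep_k : rep (coset (rcons u (t, e))) = rcons u (t, e).
  by rewrite def_k coset_rep.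
suff triv : word_eq srel [:: (((if e then coset u
     else coset (rcons u (t, false))), t), true)] [::].
  by case: e def_k rep_k triv => //= _ _ /word_eq_inv_nil.
apply: (@word_eq_rel _ _ [::] [:: _] [::]); apply: schreier_relator_triv.
case: e {def_k} rep_k => rep_k.
  by rewrite rep_u /bar rep_k; apply: word_eq_refl.
rewrite rep_k /bar.
have -> : coset (rcons (rcons u (t, false)) (t, true)) = coset u.
  exact: (coset_cancel u (t, false)).
have := word_eq_cancel (fun _ => False) u (t, false) [::].
by rewrite rep_u !cats0 -!cats1 -catA.
Qed.

Lemma tau_inv_rep k :
  word_eq srel (tauf (rep k) (inv_word (rep k))) [::].
Proof.
by rewrite -[X in tauf X]cat0s tau_from_inv; apply/word_eq_inv_nil/tau_rep.
Qed.

(** The relator [tau (K s K^-1)] is, up to its trivial outer factors, the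
    rewriting of [s] started at the coset of [K]; hence [s] rewrites to a
    trivial word from every coset. *)
Lemma tau_from_rel pre s : rel s -> word_eq srel (tauf pre s) [::].
Proof.
move=> rel_s; set k := coset pre.
have -> : tauf pre s = tauf (rep k) s.
  by apply: tau_from_coset; rewrite coset_rep.
have := schreier_relator_conj val phi rep k rel_s.
rewrite /tau /conj_word !tau_from_cat /=.
rewrite (@tau_from_coset (rep k ++ s) (rep k)); last first.
  by rewrite coset_cat /coset_of_word (rel_eval rel_s) phi1 mulg1.
move=> /(@word_eq_rel _ _ [::] _ [::]); rewrite cats0 /=.
apply: word_eq_trans; apply: word_eq_sym.
rewrite -[X in word_eq _ _ X]cat0s; apply: word_eq_cat (tau_rep k) _.
rewrite -[X in word_eq _ _ X]cats0.
exact: word_eq_cat (word_eq_refl _ _) (tau_inv_rep k).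
Qed.

Lemma tau_from_word_eq pre w w' :
  word_eq rel w w' -> word_eq srel (tauf pre w) (tauf pre w').
Proof.
elim=> {w w'} [w|w w' _|w w' w'' _ IH1 _ IH2|u c v|u s v rel_s].
- exact: word_eq_refl.
- exact: word_eq_sym.
- exact: word_eq_trans IH1 IH2.
- rewrite !tau_from_cat; apply: word_eq_cat; first exact: word_eq_refl.
  rewrite -cat_rcons cats1.
  rewrite (@tau_from_coset (rcons _ _) (pre ++ u)) ?coset_cancel //.
  rewrite -[X in word_eq _ _ X]cat0s.
  apply: word_eq_cat; last exact: word_eq_refl.
  (* As [c c^-1 = c ++ inv_word c], it rewrites to a word and its inverse. *)
  rewrite -[[:: c; _]]/([:: c] ++ inv_word [:: c]).
  by rewrite tau_from_cat tau_from_inv; apply: word_eq_invr.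
- rewrite !tau_from_cat; apply: word_eq_cat; first exact: word_eq_refl.
  rewrite (@tau_from_coset ((pre ++ u) ++ s) (pre ++ u)); last first.
    by rewrite coset_cat {2}/coset_of_word (rel_eval rel_s) phi1 mulg1.
  rewrite -[X in word_eq _ _ X]cat0s.
  by apply: word_eq_cat (tau_from_rel _ rel_s) _; apply: word_eq_refl.
Qed.

(** * Spelling Schreier symbols as words in the generators *)

Definition spell_gen (s : G * T) : word T :=
  let kv := rcons (rep s.1) (s.2, true) in kv ++ inv_word (barw kv).

Definition spell_letter (c : (G * T) * bool) : word T :=
  if c.2 then spell_gen c.1 else inv_word (spell_gen c.1).

Definition spell (w : word (G * T)) : word T := flatten (map spell_letter w).

Lemma eval_spell_gen s : eval val (spell_gen s) = sgen s.
Proof.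
case: s => k t; rewrite /spell_gen /= eval_cat eval_inv -{1}cats1 eval_cat.
by rewrite eval_cons eval_nil mulg1.
Qed.

Lemma eval_spell (w : word (G * T)) : eval val (spell w) = eval sgen w.
Proof.
elim: w => [|[s e] w IH]; first by rewrite !eval_nil.
rewrite [spell _]/= eval_cat eval_cons [X in (_ * X)%g]IH; congr (_ * _)%g.
by case: e; rewrite /spell_letter /eval_letter /= ?eval_inv eval_spell_gen.
Qed.

Lemma phi_sgen s : phi (sgen s) = 1%g.
Proof.
rewrite -eval_spell_gen -[LHS]/(coset _) /spell_gen coset_cat coset_inv.
by rewrite coset_rep mulgV.
Qed.

(** Rewriting [K v (bar (K v))^-1] gives [S_{K,v}] between the rewritings of a
    representative and of an inverse representative, both trivial. *)
Lemma tau_spell_gen s : word_eq srel (tauf [::] (spell_gen s)) [:: (s, true)].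
Proof.
case: s => k t; rewrite /spell_gen /= tau_from_cat.
set kt := rcons _ _.
rewrite (@tau_from_coset ([::] ++ kt) (barw kt)) ?coset_rep //.
rewrite -[X in word_eq _ _ X]cats0.
apply: word_eq_cat _ (tau_inv_rep _).
rewrite /kt -cats1 tau_from_cat /= coset_rep -[X in word_eq _ _ X]cat0s.
by apply: word_eq_cat (tau_rep k) _; apply: word_eq_refl.
Qed.

(** Spelled symbols lie in the kernel, so after each of them the rewriting
    restarts at the trivial coset and treats the next one independently. *)
Lemma tau_spell (w : word (G * T)) : word_eq srel (tauf [::] (spell w)) w.
Proof.
elim: w => [|[s e] w IH]; first exact: word_eq_refl.
have coset_s : coset (spell_gen s) = 1%g.
  by rewrite /coset_of_word eval_spell_gen phi_sgen.
rewrite [spell _]/= tau_from_cat -cat1s; apply: word_eq_cat.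
  case: e; first exact: tau_spell_gen.
  rewrite /spell_letter /= (@tau_from_coset _ ([::] ++ spell_gen s)).
    by rewrite tau_from_inv; apply: (word_eq_inv (tau_spell_gen s)).
  by rewrite coset_s coset_nil.
rewrite (@tau_from_coset _ [::]) //.
by rewrite coset_nil; case: e; rewrite /spell_letter /= ?coset_inv coset_s ?invg1.
Qed.

(** * The presentation of the kernel *)

Theorem reidemeister_schreier : presents [set y | phi y = 1%g] sgen srel.
Proof.
split=> [s|h phi_h|w]; first exact: phi_sgen.
  have [//|w def_h] := presents_gen presT (h := h).
  by exists (tau val phi w); rewrite eval_tau // /coset_of_word def_h.
split=> [|eq_w].
  rewrite -eval_spell => /(presents_rel presT) /(tau_from_word_eq [::]).
  exact/word_eq_trans/word_eq_sym/tau_spell.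
rewrite -(eval_nil sgen); apply: word_eq_eval eq_w => _ [k s rel_s|k t eq_kt].
  have conj1 : eval val (conj_word rep k s) = 1%g.
    by rewrite /conj_word !eval_cat eval_inv (rel_eval rel_s) mul1g mulgV.
  by rewrite eval_tau ?conj1 // /coset_of_word conj1 phi1.
rewrite eval_cons eval_nil mulg1 -[eval_letter _ _]/(sgen (k, t)).
rewrite -eval_spell_gen /spell_gen /= eval_cat eval_inv.
by rewrite (word_eq_eval _ eq_kt) ?mulgV.
Qed.

End ReidemeisterSchreier.

Theorem theorem5p1 (R : realType) (Gam0 : groupType) (G : finGroupType)
    (act : Gam0 -> Cplx R -> Cplx R) (phi : Gam0 -> G)
    (S S0 : topologicalType) (p : Cplx R -> S) (p0 : Cplx R -> S0)
    (aut : G -> S -> S) (q : S -> S0)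
    (g g0 r : nat) (m : 'I_r -> nat)
    (a b : 'I_g0 -> Gam0) (x : 'I_r -> Gam0)
    (rep : G -> word (gen g0 r)) :
  surface_setting act phi p p0 aut q g g0 m x ->
  presents setT (gen_val a b x) (fuchsian_relator m) ->
  schreier_system (gen_val a b x) phi rep ->
  presents [set y | phi y = 1%g]
    (schreier_gen (gen_val a b x) phi rep)
    (schreier_relator (gen_val a b x) phi rep (fuchsian_relator m)).
Proof.
move=> setting; exact: reidemeister_schreier (setting_morph setting).
Qed.
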